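(* Let $A$ be a division ring, and let $\Gamma$ be a totally ordered additive abelian group. Let $\omega:\Gamma\to\operatorname{Aut}(A)$, $\gamma\mapsto\omega_\gamma$, and $f:\Gamma\times\Gamma\to A^*$ be maps satisfying $$\omega_\gamma(f(\delta,\varepsilon))\,f(\gamma,\delta+\varepsilon)=f(\gamma,\delta)\,f(\gamma+\delta,\varepsilon)\quad\text{and}\quad \omega_\gamma\omega_\delta(a)=f(\gamma,\delta)\,\omega_{\gamma+\delta}(a)\,f(\gamma,\delta)^{-1}$$ for all $\gamma,\delta,\varepsilon\in\Gamma$ and $a\in A$, and $\omega_0=\operatorname{id}_A$, $f(0,\gamma)=f(\gamma,0)=1$ for all $\gamma\in\Gamma$. Let $D=A((\Gamma;\omega,f))$ be the corresponding Mal'cev--Neumann division ring. Suppose that at least one of the following conditions holds: (1) $\omega_\gamma(a)\ne a$ for some $\gamma>0$ and $a\in A$; (2) $f(\gamma,\delta)\ne f(\delta,\gamma)$ for some $\gamma,\delta>0$; (3) $a\,\omega_\gamma(b)\ne b\,\omega_\gamma(a)$ for some $\gamma>0$ and $a,b\in A$. Then $D^*$ contains no abelian maximal subgroup.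
   Context: For a division ring $R$, $R^*=R\setminus\{0\}$ is its multiplicative group. The elements of $A((\Gamma;\omega,f))$ are the formal series $\varphi=\sum_{\gamma\in\Gamma}a_\gamma z^\gamma$ with $a_\gamma\in A$ whose support $\{\gamma:a_\gamma\ne0\}$ is well-ordered; addition is coefficientwise and multiplication is determined by $z^\gamma a=\omega_\gamma(a)z^\gamma$ and $z^\gamma z^\delta=f(\gamma,\delta)z^{\gamma+\delta}$, for $a\in A$, $\gamma,\delta\in\Gamma$. A maximal subgroup of a group $G$ is a proper subgroup not properly contained in any proper subgroup of $G$. *)

(* Defs.v *)
From HB Require Import structures.
From mathcomp Require Import all_boot all_order all_algebra.
From mathcomp Require Import all_classical wochoice.

Set Implicit Arguments.
Unset Strict Implicit.
Unset Printing Implicit Defensive.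

Import Order.TTheory GRing.Theory Num.Theory.
Local Open Scope classical_set_scope.
Local Open Scope ring_scope.

(* MathComp has no structure of division rings: a division ring is a
   [unitRingType] (in which 1 != 0) satisfying [division_ring]. *)
Definition division_ring (R : unitRingType) : Prop :=
  forall x : R, x != 0 -> x \is a GRing.unit.

(* [porderZmodType] does not relate the order and the addition. *)
Definition totally_ordered_group (G : porderZmodType) : Prop :=
  total (<=%R : rel G) /\ (forall x y z : G, x <= y -> x + z <= y + z).

(* The series sum_g (phi g) z^g is encoded by its coefficient function. *)
Definition mn_carrier (G : porderZmodType) (A : unitRingType) : set (G -> A) :=
  [set phi | wo_chain (<=%R : rel G) (support phi)].

Definition mn_monomial (G : porderZmodType) (A : unitRingType)
    (g : G) (a : A) : G -> A :=
  fun d => if d == g then a else 0.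

(* (a z^g) (b z^d) = a omega_g(b) f(g, d) z^(g + d), extended to series. On
   [mn_carrier] only finitely many terms of the sum are nonzero; [\sum_(_ \in _)]
   is 0 when infinitely many are. *)
Definition mn_mul (G : porderZmodType) (A : unitRingType)
    (omega : G -> {rmorphism A -> A}) (f : G -> G -> A) (phi psi : G -> A) :
    G -> A :=
  fun g => \sum_(h \in [set: G]) phi h * omega h (psi (g - h)) * f h (g - h).

Definition mn_one (G : porderZmodType) (A : unitRingType) : G -> A :=
  mn_monomial 0 1.

Definition mn_star (G : porderZmodType) (A : unitRingType) : set (G -> A) :=
  [set phi | mn_carrier phi /\ phi <> (fun=> 0)].

Arguments mn_carrier : clear implicits.
Arguments mn_one : clear implicits.
Arguments mn_star : clear implicits.

Lemma mn_mul_monomial (G : porderZmodType) (A : unitRingType)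
    (omega : G -> {rmorphism A -> A}) (f : G -> G -> A) (g d : G) (a b : A) :
  mn_mul omega f (mn_monomial g a) (mn_monomial d b)
  = mn_monomial (g + d) (a * omega g b * f g d).
Proof.
apply/funext => x; rewrite /mn_mul.
rewrite -(fsbig_widen [set g]) ?fsbig_set1 //.
  rewrite /mn_monomial eqxx subr_eq [d + g]addrC.
  by case: eqP => [->|_]; rewrite ?(addrAC g d) ?subrr ?add0r ?rmorph0 ?mulr0 ?mul0r.
move=> h /= [_ hg]; rewrite /mn_monomial.
by case: eqP => [/hg//|_]; rewrite !mul0r.
Qed.

(* Groups given by a carrier in an ambient type with a law and a unit. *)
Definition subgroup_of (T : Type) (op : T -> T -> T) (e : T) (G H : set T) :
    Prop :=
  [/\ H `<=` G, H e, (forall x y, H x -> H y -> H (op x y)) &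
      forall x, H x -> exists y, [/\ H y, op x y = e & op y x = e]].

Definition maximal_subgroup_of (T : Type) (op : T -> T -> T) (e : T)
    (G M : set T) : Prop :=
  [/\ subgroup_of op e G M, M `<` G &
      forall H : set T, subgroup_of op e G H -> H `<` G -> ~ (M `<` H)].

Definition abelian_for (T : Type) (op : T -> T -> T) (H : set T) : Prop :=
  forall x y, H x -> H y -> op x y = op y x.

(* Main.v *)
(* The map lead sending a nonzero series to its leading term a z^g is a group
   morphism on D^*. Given an abelian maximal subgroup M, the preimage H of
   lead(M) is a subgroup containing M, so H = D^* or H = M. In the first case
   all leading terms commute with each other; in the second case M contains
   every 1 + a z^g with g > 0, and comparing coefficients at g + d in the
   products of 1 + a z^g and 1 + b z^d shows again that a z^g and b z^d commute
   for g, d > 0. This contradicts each of the three conditions.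
   That H is closed under inverses rests on Neumann's lemma: the additive monoid
   generated by a well-ordered set of positive elements is well-ordered. A left
   inverse of a series then has coefficients given by well-founded recursion,
   and is two-sided by associativity. *)
Require Import Defs.
From HB Require Import structures.
From mathcomp Require Import all_boot all_order all_algebra finmap.
From mathcomp Require Import all_classical wochoice.

Set Implicit Arguments.
Unset Strict Implicit.
Unset Printing Implicit Defensive.

Import Order.TTheory GRing.Theory Num.Theory.
Local Open Scope classical_set_scope.
Local Open Scope ring_scope.

(** * Well-ordered subsets of an ordered abelian group *)

Definition well_ordered (G : porderZmodType) (S : set G) : Prop :=
  forall X : set G, X `<=` S -> X !=set0 ->
    exists2 m, X m & forall x, X x -> m <= x.

(** The Minkowski sum; the form [T (g - s)] matches the indices [h] and [g - h] in [mn_mul]. *)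
Definition sum_set (G : zmodType) (S T : set G) : set G :=
  [set g | exists2 s, S s & T (g - s)].

Inductive monoid_closure (G : zmodType) (S : set G) : set G :=
| monoid_closure0 : monoid_closure S 0
| monoid_closureD s x :
    S s -> monoid_closure S x -> monoid_closure S (s + x).

Section OrderedGroup.
Context (G : porderZmodType) (hG : totally_ordered_group G).
Implicit Types (x y z g : G) (S T X : set G).

Lemma leVlt x y : x <= y \/ y < x.
Proof.
have [tot _] := hG; case/orP: (tot x y) => [xy|yx]; first by left.
by have [->|xy] := eqVneq x y; [left|right; rewrite lt_neqAle yx andbT eq_sym].
Qed.

Lemma nlt_le x y : ~ x < y -> y <= x.
Proof. by case: (leVlt y x) => // yx /(_ yx). Qed.

Lemma le_add2r z x y : (x + z <= y + z) = (x <= y).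
Proof.
have [_ add] := hG; apply/idP/idP => [/(add _ _ (- z))|/add]; last exact.
by rewrite !addrK.
Qed.

Lemma lt_add2r z x y : (x + z < y + z) = (x < y).
Proof. by rewrite !lt_neqAle le_add2r (inj_eq (addIr z)). Qed.

Lemma le_add2l z x y : (z + x <= z + y) = (x <= y).
Proof. by rewrite ![z + _]addrC le_add2r. Qed.

Lemma lt_add2l z x y : (z + x < z + y) = (x < y).
Proof. by rewrite ![z + _]addrC lt_add2r. Qed.

Lemma le_add x y z t : x <= y -> z <= t -> x + z <= y + t.
Proof. by move=> xy zt; apply: (@le_trans _ _ (y + z)); rewrite ?le_add2r ?le_add2l. Qed.

Lemma subG_gt0 x y : (0 < y - x) = (x < y).
Proof. by rewrite -(lt_add2r x 0) add0r subrK. Qed.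

(** [wo_chain] asks for a unique minimum; antisymmetry gives the uniqueness for free. *)
Lemma wo_chainE (C : {pred G}) : wo_chain <=%R C <-> well_ordered [set` C].
Proof.
split=> [woC X XC [x Xx]|woC].
  have [||m [[mX Xm] _]] := woC (mem X).
  - by move=> y; rewrite in_setE => /XC.
  - by exists x; apply/mem_set.
  by exists m; [exact/set_mem|move=> y /mem_set /Xm].
apply: antisymmetric_wo_chain => [x y _ _ /le_anti//|B BC [x Bx]].
have [||m Bm mB] := woC [set` B]; first by move=> y /= /BC.
  by exists x.
by exists m.
Qed.

Lemma sub_well_ordered S T : S `<=` T -> well_ordered T -> well_ordered S.
Proof. by move=> ST woT X XS; apply: woT => x /XS /ST. Qed.

Lemma well_ordered_shift S g :
  well_ordered S -> well_ordered [set x | S (x + g)].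
Proof.
move=> woS X XS [x Xx].
have [||m Xm mX] := woS [set y | X (y - g)].
- by move=> y /= /XS /=; rewrite subrK.
- by exists (x + g); rewrite /= addrK.
by exists (m - g) => // y Xy; rewrite -(le_add2r g) subrK mX //= addrK.
Qed.

Lemma well_ordered_ind S (P : G -> Prop) : well_ordered S ->
  (forall x, S x -> (forall y, S y -> y < x -> P y) -> P x) ->
  forall x, S x -> P x.
Proof.
move=> woS step x Sx; apply: contrapT => nPx.
have [||m [Sm nPm] mmin] := woS [set y | S y /\ ~ P y].
- by move=> y [].
- by exists x.
apply: nPm; apply: step => // y Sy ym; apply: contrapT => nPy.
by have := lt_le_trans ym (mmin y (conj Sy nPy)); rewrite ltxx.
Qed.

Lemma well_ordered_sum S T :
  well_ordered S -> well_ordered T -> well_ordered (sum_set S T).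
Proof.
move=> woS woT.
pose Q U := forall X, X `<=` sum_set U T -> X !=set0 ->
  exists2 m, X m & forall x, X x -> m <= x.
have step U : U `<=` S ->
    (forall s, U s -> Q [set u | S u /\ u < s]) -> Q U.
  move=> US IH X XU [x Xx].
  (* [t0] is the least [T]-part occurring in [X], and [s0] a partner of it. Decompositions with
     [s0 <= s] stay above [t0 + s0]; all others have their [S]-part below [s0], where the induction
     hypothesis applies. *)
  have [||t0 [s0 Us0 [Tt0 Xst0]] t0min] :=
      woT [set t | exists2 s, U s & T t /\ X (t + s)].
  - by move=> t [s _ []].
  - by have [s Us Ts] := XU x Xx; exists (x - s), s => //; rewrite subrK.
  pose X' := X `&` sum_set [set u | S u /\ u < s0] T.
  have outX' y : X y -> X' y \/ t0 + s0 <= y.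
    move=> Xy; have [s Us Ts] := XU y Xy.
    case: (leVlt s0 s) => ss0.
      right; rewrite -(subrK s y) le_add //.
      by apply: t0min; exists s => //; rewrite subrK.
    by left; split=> //; exists s => //; split=> //; exact: US.
  have [[x' X'x']|X'0] := pselect (X' !=set0); last first.
    exists (t0 + s0) => // y Xy.
    by case: (outX' y Xy) => // X'y; case: X'0; exists y.
  have [||m [Xm _] mmin] := IH s0 Us0 X'.
  - by move=> y [].
  - by exists x'.
  case: (leVlt m (t0 + s0)) => mst.
    exists m => // y Xy; case: (outX' y Xy) => [/mmin //|].
    exact: le_trans.
  exists (t0 + s0) => // y Xy; case: (outX' y Xy) => [/mmin|//].
  by apply: le_trans; exact: ltW.
apply: (step S) => //; apply: (well_ordered_ind woS) => s Ss IH.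
by apply: step => [u []//|u [Su us]]; exact: IH.
Qed.

(** By induction every initial segment is finite: the part strictly below [s] has a maximum [m], so
    it lies in the segment up to [m]. The maximum of [S] then bounds all of [S]. *)
Lemma well_ordered_finite S : well_ordered S ->
  (forall X, X `<=` S -> X !=set0 -> exists2 m, X m & forall x, X x -> x <= m) ->
  finite_set S.
Proof.
move=> woS cowoS.
have fin s : S s -> finite_set [set u | S u /\ u <= s].
  move: s; apply: (well_ordered_ind woS) => s Ss IH.
  have -> : [set u | S u /\ u <= s] = s |` [set u | S u /\ u < s].
    apply/seteqP; split=> u /=; rewrite le_eqVlt.
      by case=> Su /orP[/eqP->|us]; [left|right].
    by case=> [->|[Su ->]]; rewrite ?eqxx ?orbT.
  rewrite finite_setU; split; first exact: finite_set1.
  have [/cowoS|/set0P/negP/negPn/eqP->] := pselect ([set u | S u /\ u < s] !=set0);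
    last exact: finite_set0.
  case=> [u []//|m [Sm ms] mmax].
  apply: sub_finite_set (IH m Sm ms) => u [Su us]; split=> //.
  exact: mmax.
have [S0|/set0P/negP/negPn/eqP->] := pselect (S !=set0); last exact: finite_set0.
have [m Sm mmax] := cowoS S (@subset_refl _ S) S0.
by apply: sub_finite_set (fin m Sm) => u Su; split=> //; exact: mmax.
Qed.

(** This makes the sums in [mn_mul] finite. As [s] increases, [g - s] decreases, so minima in [T]
    yield maxima in [S], and the set is well-ordered in both directions. *)
Lemma finite_decompositions S T g : well_ordered S -> well_ordered T ->
  finite_set [set s | S s /\ T (g - s)].
Proof.
move=> woS woT; apply: well_ordered_finite.
  by apply: sub_well_ordered woS => s [].
move=> X XS [x Xx].
have [||m Xm mmin] := woT [set t | X (g - t)].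
- by move=> t /= /XS[_]; rewrite opprB addrC subrK.
- by exists (g - x); rewrite /= opprB addrC subrK.
exists (g - m) => // y Xy.
rewrite -(le_add2r m) subrK -(le_add2l (- y)) addrA addNr add0r addrC.
by apply: mmin; rewrite /= opprB addrC subrK.
Qed.

Lemma well_ordered_seq (r : seq G) : well_ordered [set g | g \in r].
Proof.
elim: r => [|x r IH] X Xr [y Xy]; first by have := Xr y Xy.
have [[z [Xz zr]]|nor] := pselect (X `&` [set g | g \in r] !=set0).
  have [||m [Xm mr] mmin] := IH (X `&` [set g | g \in r]).
  - by move=> u [].
  - by exists z.
  have [Xx|nXx] := pselect (X x); last first.
    exists m => // u Xu; have := Xr u Xu; rewrite /= inE => /orP[/eqP ux|ur].
      by rewrite ux in Xu.
    exact: mmin.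
  case: (leVlt m x) => [mx|/ltW xm].
    exists m => // u Xu; have := Xr u Xu; rewrite /= inE => /orP[/eqP->//|ur].
    exact: mmin.
  exists x => // u Xu; have := Xr u Xu; rewrite /= inE => /orP[/eqP->//|ur].
  by apply: le_trans xm _; exact: mmin.
have only u : X u -> u = x.
  move=> Xu; have := Xr u Xu; rewrite /= inE => /orP[/eqP//|ur].
  by case: nor; exists u.
by exists x => [|u /only-> //]; rewrite -(only y Xy).
Qed.

(* Call x good if no nonempty subset without minimum reaches down to x. The
   good elements are well-ordered, and below every bad x there is a bad s + y
   with s in S and y good; since such sums are well-ordered, there would be a
   least bad element. *)
Lemma well_ordered_monoid_closure S : (forall s, S s -> 0 < s) ->
  well_ordered S -> well_ordered (monoid_closure S).
Proof.
move=> Spos woS; set T := monoid_closure S.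
pose good x := forall X, X `<=` T -> (exists2 y, X y & y <= x) ->
  exists2 m, X m & forall y, X y -> m <= y.
have Tge0 x : T x -> 0 <= x.
  elim=> // s y /Spos/ltW s0 _ y0.
  by rewrite -[0]addr0 le_add.
have smaller_bad x : ~ good x -> exists2 y, T y /\ ~ good y & y < x.
  move=> badx; apply: contrapT => nobad; apply: badx => X XT [y Xy yx].
  apply: contrapT => nomin.
  have [z Xz zy] : exists2 z, X z & z < y.
    apply: contrapT => noz; apply: nomin; exists y => // z Xz.
    by apply: nlt_le => zy; apply: noz; exists z.
  apply: nobad; exists z; last exact: lt_le_trans zy yx.
  split; first exact: XT.
  by move=> goodz; apply/nomin/goodz => //; exists z.
have below_bad x : T x -> ~ good x ->
    exists2 y, sum_set S (T `&` good) y /\ ~ good y & y <= x.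
  elim=> [bad0|s y Ss Ty IH badx].
    have [y [Ty _] y0] := smaller_bad 0 bad0.
    by have := le_lt_trans (Tge0 _ Ty) y0; rewrite ltxx.
  have [goody|bady] := pselect (good y).
    by exists (s + y); [split=> //; exists s; rewrite // addrAC subrr add0r|].
  have [z badz zy] := IH bady; exists z => //.
  by rewrite -[z]add0r le_add // ltW // Spos.
have wogood : well_ordered (T `&` good).
  move=> X XTg [x Xx]; have [_ goodx] := XTg x Xx.
  by apply: goodx; [move=> y /XTg[]|exists x].
have allgood x : T x -> good x.
  move=> Tx; apply: contrapT => badx.
  have [||m [_ badm] mmin] :=
      well_ordered_sum woS wogood (X := [set y | sum_set S (T `&` good) y /\ ~ good y]).
  - by move=> y [].
  - by have [y] := below_bad x Tx badx; exists y.
  have [y [Ty bady] ym] := smaller_bad m badm.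
  have [z sz zy] := below_bad y Ty bady.
  by have := le_lt_trans (le_trans (mmin z sz) zy) ym; rewrite ltxx.
move=> X XT [x Xx]; apply: (allgood x) => //; first exact: XT.
by exists x.
Qed.

(** Only points of [S] count as predecessors, so the recursion is well-founded on all of [G], and
    [psi] is defined outside [S] too. [F] sees the default [a0] wherever it may not look. *)
Lemma well_ordered_rec (A : Type) (a0 : A) S (F : G -> (G -> A) -> A) :
  well_ordered S -> exists psi : G -> A,
    forall x, psi x = F x (fun y => if `[< S y >] && (y < x) then psi y else a0).
Proof.
move=> woS; pose R y x := S y /\ y < x.
have wfR : well_founded R.
  have accS : forall y, S y -> Acc R y.
    apply: (well_ordered_ind woS) => x Sx IH.
    by constructor=> y [Sy yx]; exact: IH.
  by move=> x; constructor=> y [/accS].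
have dec y x : `[< S y >] && (y < x) -> R y x by case/andP=> /asboolP.
(* The dependent [if] hands [rec] the proof that its test succeeded. *)
pose body x (rec : forall y, R y x -> A) :=
  F x (fun y => (if `[< S y >] && (y < x) as b
                  return (b -> R y x) -> A
                 then fun h => rec y (h isT) else fun=> a0) (@dec y x)).
exists (Fix wfR (fun=> A) body) => x.
rewrite Fix_eq /body.
  by congr F; apply/funext => y; move: (@dec y x); case: (_ && _).
move=> y r1 r2 r12; congr F; apply/funext => z.
by move: (@dec z y); case: (_ && _).
Qed.

End OrderedGroup.

(** * The product of series and its associativity *)

Section Series.
Context (A : unitRingType) (hA : division_ring A).
Context (G : porderZmodType) (hG : totally_ordered_group G).
Context (omega : G -> {rmorphism A -> A}) (f : G -> G -> A).
Context (f_neq0 : forall g d, f g d != 0).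
Context (f_cocycle : forall g d e,
  omega g (f d e) * f g (d + e) = f g d * f (g + d) e).
Context (omega_comp : forall g d a,
  omega g (omega d a) = f g d * omega (g + d) a * (f g d)^-1).
Context (omega0 : forall a, omega 0 a = a).
Context (f0l : forall g, f 0 g = 1) (f0r : forall g, f g 0 = 1).
Implicit Types (phi psi chi : G -> A) (g h d k x : G) (a b c : A).

Local Notation mul := (mn_mul omega f).
Local Notation one := (mn_one G A).
Local Notation carrier := (mn_carrier G A).
Local Notation supp phi := [set g | phi g != 0].

Lemma division_ring_mulf_neq0 a b : a != 0 -> b != 0 -> a * b != 0.
Proof.
move=> /hA ua b0; apply: contraNneq b0 => ab0.
by rewrite -(mulKr ua b) ab0 mulr0.
Qed.

Lemma omega_neq0 g a : a != 0 -> omega g a != 0.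
Proof. by move=> /hA /(rmorph_unit (omega g)); apply: contraTneq => ->; rewrite unitr0. Qed.

Lemma mn_carrierE phi : carrier phi <-> well_ordered (supp phi).
Proof. exact: wo_chainE. Qed.

(** Any finite set containing the contributing indices may serve as index set, so that sums can be
    split and exchanged. *)
Lemma mn_mul_seq phi psi g (H : set G) : finite_set H ->
    (forall h, phi h != 0 -> psi (g - h) != 0 -> H h) ->
  mul phi psi g
  = \sum_(h <- fset_set H) phi h * omega h (psi (g - h)) * f h (g - h).
Proof.
move=> finH suppH; rewrite /mn_mul; apply: fsbigTE => h.
rewrite in_fset_set // notin_setE => nHh.
have [->|phi0] := eqVneq (phi h) 0; first by rewrite !mul0r.
have [->|psi0] := eqVneq (psi (g - h)) 0; first by rewrite rmorph0 mulr0 mul0r.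
by case: nHh; exact: suppH.
Qed.

Lemma mn_mul_single phi psi g x :
    (forall h, h != x -> phi h != 0 -> psi (g - h) = 0) ->
  mul phi psi g = phi x * omega x (psi (g - x)) * f x (g - x).
Proof.
move=> single; rewrite (@mn_mul_seq _ _ _ [set x]) //.
  by rewrite fset_set1 big_seq_fset1.
move=> h phih; apply: contraNP => /= /eqP hx.
by rewrite single.
Qed.

Lemma mn_mul_supp phi psi g :
  mul phi psi g != 0 -> sum_set (supp phi) (supp psi) g.
Proof.
apply: contraNP => nS; rewrite /mn_mul fsbig1 // => h _.
have [->|phi0] := eqVneq (phi h) 0; first by rewrite !mul0r.
have [->|psi0] := eqVneq (psi (g - h)) 0; first by rewrite rmorph0 mulr0 mul0r.
by case: nS; exists h.
Qed.

Lemma mn_carrier_mul phi psi :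
  carrier phi -> carrier psi -> carrier (mul phi psi).
Proof.
move=> /mn_carrierE wophi /mn_carrierE wopsi; apply/mn_carrierE.
apply: sub_well_ordered (well_ordered_sum hG wophi wopsi) => g.
exact: mn_mul_supp.
Qed.

Lemma mn_mul1 phi : mul phi one = phi.
Proof.
apply/funext => g; rewrite (@mn_mul_single _ _ _ g).
  by rewrite subrr /mn_one /mn_monomial eqxx rmorph1 f0r !mulr1.
by move=> h hg _; rewrite /mn_one /mn_monomial subr_eq0 eq_sym (negPf hg).
Qed.

Lemma mn_1mul phi : mul one phi = phi.
Proof.
apply/funext => g; rewrite (@mn_mul_single _ _ _ 0).
  by rewrite subr0 /mn_one /mn_monomial eqxx omega0 f0l mul1r mulr1.
by move=> h h0; rewrite /mn_one /mn_monomial (negPf h0) eqxx.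
Qed.

Lemma mn_mulA phi psi chi : carrier phi -> carrier psi -> carrier chi ->
  mul phi (mul psi chi) = mul (mul phi psi) chi.
Proof.
move=> /mn_carrierE wophi /mn_carrierE wopsi /mn_carrierE wochi.
apply/funext => g.
pose K := [set k | supp phi k /\ sum_set (supp psi) (supp chi) (g - k)].
pose H := [set h | sum_set (supp phi) (supp psi) h /\ supp chi (g - h)].
have finK : finite_set K.
  by apply: finite_decompositions => //; exact: well_ordered_sum.
have finH : finite_set H.
  by apply: finite_decompositions => //; exact: well_ordered_sum.
(* The term with degrees [k] from [phi], [h - k] from [psi] and [g - h] from [chi]. Both bracketings
   are the sum of [t k h] over [K] and [H]. *)
pose t k h := phi k * omega k (psi (h - k)) * f k (h - k)
  * omega h (chi (g - h)) * f h (g - h).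
have t_eq0 k h : (phi k == 0) || (psi (h - k) == 0) || (chi (g - h) == 0) ->
    t k h = 0.
  by rewrite /t => /orP[/orP[]|] /eqP->; rewrite ?rmorph0 ?mulr0 ?mul0r.
transitivity (\sum_(k <- fset_set K) \sum_(h <- fset_set H) t k h).
  rewrite (mn_mul_seq finK); last by move=> k phik /mn_mul_supp.
  apply: eq_big_seq => k; rewrite in_fset_set // inE => -[phik _].
  have shiftE h : g - k - (h - k) = g - h by rewrite opprB subrKA.
  have -> : mul psi chi (g - k) = \sum_(h <- fset_set H)
      psi (h - k) * omega (h - k) (chi (g - h)) * f (h - k) (g - h).
    (* The substitution makes [h] the combined degree of [phi] and [psi], which is the outer index
       of the other bracketing. *)
    rewrite /mn_mul (@reindex_fsbigT _ _ _ _ _ (fun h => h - k)); last first.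
      by exists (+%R^~ k) => h; rewrite ?subrK ?addrK.
    under eq_fsbigr do rewrite shiftE.
    apply: fsbigTE => h; rewrite in_fset_set // notin_setE => nHh.
    have [->|psi0] := eqVneq (psi (h - k)) 0; first by rewrite !mul0r.
    have [->|chi0] := eqVneq (chi (g - h)) 0.
      by rewrite rmorph0 mulr0 mul0r.
    by case: nHh; split=> //; exists k.
  rewrite rmorph_sum mulr_sumr mulr_suml; apply: eq_bigr => h _.
  have gkE : g - k = h - k + (g - h) by rewrite [RHS]addrC subrKA.
  have khE : k + (h - k) = h by rewrite addrC subrK.
  (* [omega_comp] leaves an inverse of [f k (h - k)], which cancels against the first factor
     produced by the cocycle identity. *)
  rewrite /t !rmorphM omega_comp gkE khE !mulrA -[_ * omega k (f _ _) * _]mulrA.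
  by rewrite f_cocycle khE !mulrA mulrVK //; exact: hA.
rewrite exchange_big /= (mn_mul_seq finH); last by move=> h /mn_mul_supp.
apply: eq_big_seq => h; rewrite in_fset_set // inE => -[_ chih].
rewrite (mn_mul_seq finK); first by rewrite !mulr_suml.
move=> k phik psik; split=> //; exists (h - k) => //=.
by rewrite opprB subrKA.
Qed.

(** * Leading terms *)

Definition leading_term phi g a : Prop :=
  [/\ phi g = a, a != 0 & forall h, h < g -> phi h = 0].

Lemma leading_term_uniq phi g a h b :
  leading_term phi g a -> leading_term phi h b -> g = h /\ a = b.
Proof.
move=> [ga a0 gmin] [hb b0 hmin]; suff gh : g = h by rewrite -ga -hb gh.
case: (leVlt hG g h) => [gh|/gmin ph0]; last by rewrite -hb ph0 eqxx in b0.
apply/eqP; apply: contraTT (a0) => gNh.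
by rewrite -ga hmin ?eqxx // lt_neqAle gNh.
Qed.

Lemma leading_term_exists phi :
  mn_star G A phi -> exists g a, leading_term phi g a.
Proof.
case=> /mn_carrierE wophi phiN0.
have [||g phig gmin] := wophi (supp phi); first by [].
  apply: contrapT => /set0P/negP/negPn/eqP supp0; apply: phiN0.
  apply/funext => g; apply/eqP/negP => /negP phig.
  by have : set0 g by rewrite -supp0.
exists g, (phi g); split=> // h hg; apply/eqP/negP => /negP phih.
by have := lt_le_trans hg (gmin h phih); rewrite ltxx.
Qed.

(** At [g + d] only [h = g] contributes: any other [h] in the support of [phi] exceeds [g], so
    [g + d - h] falls below [d]. The result is the product of the two leading monomials, as in
    [mn_mul_monomial]. *)
Lemma leading_term_mul phi psi g d a b :
    leading_term phi g a -> leading_term psi d b ->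
  leading_term (mul phi psi) (g + d) (a * omega g b * f g d).
Proof.
move=> [<- a0 gmin] [<- b0 dmin]; split.
- rewrite (@mn_mul_single _ _ _ g); first by rewrite [g + d]addrC addrK.
  move=> h hg phih; apply: dmin.
  rewrite -(lt_add2r hG h) subrK addrC lt_add2l // lt_neqAle eq_sym hg /=.
  by apply: nlt_le => // /gmin phi0; rewrite phi0 eqxx in phih.
- by rewrite !division_ring_mulf_neq0 ?omega_neq0.
move=> h hgd; rewrite /mn_mul fsbig1 // => k _.
case: (leVlt hG g k) => [gk|/gmin ->]; last by rewrite !mul0r.
rewrite dmin ?rmorph0 ?mulr0 ?mul0r //.
rewrite -(lt_add2r hG k) subrK; apply: lt_le_trans hgd _.
by rewrite addrC le_add2l.
Qed.

Lemma leading_term_star phi g a :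
  carrier phi -> leading_term phi g a -> mn_star G A phi.
Proof. by move=> cphi [phig a0 _]; split=> // phi0; rewrite -phig phi0 eqxx in a0. Qed.

Lemma leading_term_monomial g a :
  a != 0 -> leading_term (mn_monomial g a) g a.
Proof.
by move=> a0; rewrite /mn_monomial; split=> [|//|h]; rewrite ?eqxx // => /lt_eqF->.
Qed.

Lemma mn_carrier_seq phi (r : seq G) :
  (forall g, phi g != 0 -> g \in r) -> carrier phi.
Proof.
move=> phir; apply/mn_carrierE.
by apply: sub_well_ordered (well_ordered_seq hG (r := r)) => g; exact: phir.
Qed.

Lemma mn_carrier_monomial g a : carrier (mn_monomial g a).
Proof.
apply: (@mn_carrier_seq _ [:: g]) => h; rewrite /mn_monomial inE.
by case: (h == g); rewrite ?eqxx.
Qed.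

Lemma leading_term_one : leading_term one 0 1.
Proof. exact/leading_term_monomial/oner_neq0. Qed.

(** * Inverses and their leading terms *)

Lemma mn_left_inverse phi : mn_star G A phi ->
  exists2 psi, mn_star G A psi & mul psi phi = one.
Proof.
move=> sphi; have [g [a [phig a0 gmin]]] := leading_term_exists sphi.
case: sphi => /mn_carrierE wophi _.
(* Degrees are measured from the leading degree [g]. [T], the monoid generated by [S] shifted by
   [- g], will contain the support of the inverse. *)
pose S : set G := [set s | 0 < s /\ phi (s + g) != 0].
pose T := [set x | monoid_closure S (x + g)].
have woS : well_ordered S.
  by apply: sub_well_ordered (well_ordered_shift hG (g := g) wophi) => s [].
have woT : well_ordered T.
  apply: (well_ordered_shift hG); apply: well_ordered_monoid_closure => //.
  by move=> s [].
(* The coefficient of [mul psi phi] at [x + g] is [psi x * u x] plus terms in [psi y] with [y < x];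
   solving for [psi x] gives the recursion below. *)
pose u x := omega x a * f x g.
have uU x : u x \is a GRing.unit.
  by apply/hA/division_ring_mulf_neq0 => //; exact: omega_neq0.
have [psi psiE] := well_ordered_rec 0
  (fun x r => (one (x + g) - mul r phi (x + g)) / u x) woT.
pose r x y := if `[< T y >] && (y < x) then psi y else 0.
have psiT x : psi x != 0 -> T x.
  apply: contraNP => nTx; rewrite psiE -/(r x).
  have /eqP xg0 : x + g != 0.
    by apply: contra_notN nTx => /eqP; rewrite /T /= => ->; exact: monoid_closure0.
  rewrite [one _]/mn_one /mn_monomial (negPf (introN eqP xg0)).
  suff -> : mul (r x) phi (x + g) = 0 by rewrite subr0 mul0r.
  apply/eqP/negP => /negP/mn_mul_supp[y /=]; rewrite /r.
  case: asboolP => [Ty|_]; last by rewrite eqxx.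
  case: ifP => [yx _ phiy|_]; last by rewrite eqxx.
  (* A nonzero contribution from [y] in [T] writes [x + g] as [x - y] in [S] plus [y + g] in the
     monoid. *)
  case: nTx; rewrite /T /= -[x](subrK y) -addrA.
  apply: monoid_closureD => //; split; first by rewrite subG_gt0.
  by rewrite addrAC.
have cpsi : carrier psi by apply/mn_carrierE; exact: sub_well_ordered woT.
have psiphi : mul psi phi = one.
  apply/funext => k; rewrite -[k](subrK g); move: (k - g) => {k} x.
  (* The point [x] is added even if it lies outside [T], so that its term can be split off from the
     sum. *)
  pose H := x |` [set y | T y /\ supp phi (x + g - y)].
  have finH : finite_set H.
    by rewrite finite_setU; split=> //; exact: finite_decompositions.
  have rE : mul (r x) phi (x + g) = one (x + g) - psi x * u x.
    by rewrite psiE -/(r x) mulrVK // subKr.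
  rewrite (mn_mul_seq finH); last by move=> y /psiT; right.
  rewrite -[RHS](subrK (psi x * u x)) -rE (mn_mul_seq finH); last first.
    move=> y; rewrite /r; case: asboolP => [Ty _ phiy|_]; last by rewrite eqxx.
    by right.
  have xH : x \in fset_set H by rewrite in_fset_set // inE; left.
  rewrite !(big_fsetD1 x xH) /= /r ltxx andbF !mul0r add0r addrC.
  rewrite [x + g]addrC addrK phig mulrA; congr (_ + _).
  apply: eq_big_seq => y; rewrite in_fsetD1 => /andP[yx yH].
  have [psi0|/psiT Ty] := eqVneq (psi y) 0; first by rewrite psi0 if_same.
  (* For [y > x] the truncation [r x] vanishes, but so does [phi (x + g - y)], its argument being
     below [g]. *)
  rewrite (asboolT Ty) /=; case: ifP => // /negP/(nlt_le hG) xy.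
  rewrite gmin ?rmorph0 ?mulr0 ?mul0r // -(lt_add2r hG y) subrK lt_add2l //.
  by rewrite lt_neqAle eq_sym yx.
exists psi => //; split=> // psi0.
have := congr1 (fun s => s 0) psiphi; rewrite /mn_mul fsbig1; last first.
  by move=> h _; rewrite psi0 !mul0r.
by rewrite /mn_one /mn_monomial eqxx => /esym/eqP; rewrite oner_eq0.
Qed.

(** With [chi] a left inverse of [psi], [phi = (chi psi) phi = chi (psi phi) = chi]. *)
Lemma mn_inverse phi : mn_star G A phi ->
  exists psi, [/\ mn_star G A psi, mul phi psi = one & mul psi phi = one].
Proof.
move=> sphi; have [psi spsi psiphi] := mn_left_inverse sphi.
have [chi schi chipsi] := mn_left_inverse spsi.
have phichi : phi = chi; last by exists psi; split; rewrite // phichi.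
case: sphi spsi schi => [cphi _] [cpsi _] [cchi _].
by rewrite -[LHS]mn_1mul -chipsi -mn_mulA // psiphi mn_mul1.
Qed.

(** Degrees add up to 0, and [a * omega g b * f g d = 1] determines [b] because [a] and [f g d] are
    units and [omega g] is injective. *)
Lemma leading_term_inverse phi psi phi' psi' g a d b d' b' :
    mul phi psi = one -> mul phi' psi' = one ->
    leading_term phi g a -> leading_term phi' g a ->
    leading_term psi d b -> leading_term psi' d' b' ->
  d = d' /\ b = b'.
Proof.
move=> e e' lphi lphi' lpsi lpsi'.
have := leading_term_mul lphi lpsi; rewrite e => /(leading_term_uniq leading_term_one)[gd ab].
have := leading_term_mul lphi' lpsi'; rewrite e' => /(leading_term_uniq leading_term_one)[gd' ab'].
have dd' : d = d' by apply: (addrI g); rewrite -gd -gd'.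
split=> //; subst d'; move: ab; rewrite ab'.
case: lphi => _ /hA ua _; move=> /mulIr - /(_ (hA (f_neq0 g d))) /(mulrI ua).
move=> /eqP; rewrite -subr_eq0 -rmorphB => bb'; apply/esym/eqP.
by rewrite -subr_eq0; apply: contraTT bb'; exact: omega_neq0.
Qed.

(** * The series [1 + a z^g] and abelian maximal subgroups *)

Definition one_plus_monomial g a : G -> A :=
  fun h => if h == 0 then 1 else mn_monomial g a h.

Lemma leading_term_one_plus g a :
  0 < g -> leading_term (one_plus_monomial g a) 0 1.
Proof.
move=> g0; rewrite /one_plus_monomial /mn_monomial.
split=> [||h h0]; rewrite ?eqxx ?oner_neq0 //.
by rewrite (lt_eqF h0) (lt_eqF (lt_trans h0 g0)).
Qed.

Lemma mn_carrier_one_plus g a : carrier (one_plus_monomial g a).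
Proof.
apply: (@mn_carrier_seq _ [:: 0; g]) => h.
rewrite /one_plus_monomial /mn_monomial !inE.
by case: (h == 0); case: (h == g); rewrite ?eqxx.
Qed.

(** The index [h = 0] contributes nothing, since [g + d] exceeds both 0 and [d]; this leaves only
    [h = g]. *)
Lemma mul_one_plus_coef g d a b : 0 < g -> 0 < d ->
  mul (one_plus_monomial g a) (one_plus_monomial d b) (g + d)
  = a * omega g b * f g d.
Proof.
move=> g0 d0; rewrite (@mn_mul_single _ _ _ g).
  rewrite [g + d]addrC addrK /one_plus_monomial /mn_monomial.
  by rewrite (gt_eqF g0) (gt_eqF d0) !eqxx.
move=> h; rewrite /one_plus_monomial {1}/mn_monomial => /negPf->.
have [-> _|] := eqVneq h 0; last by rewrite eqxx.
have gd0 : 0 < g + d by apply: lt_trans d0 _; rewrite -[ltLHS]add0r lt_add2r.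
by rewrite subr0 gt_eqF // /mn_monomial gt_eqF // -[ltLHS]add0r lt_add2r.
Qed.

Lemma abelian_maximal_leading_comm (M : set (G -> A)) g d a b :
    maximal_subgroup_of mul one (mn_star G A) M -> abelian_for mul M ->
    0 < g -> 0 < d -> a != 0 -> b != 0 ->
  a * omega g b * f g d = b * omega d a * f d g.
Proof.
move=> [[Msub M1 MM MV] _ Mmax] Mab g0 d0 a0 b0.
pose H := [set phi | mn_star G A phi /\ exists2 m, M m &
  exists h c, leading_term phi h c /\ leading_term m h c].
have Hsub : H `<=` mn_star G A by move=> phi [].
have [HT|HNT] := pselect (mn_star G A `<=` H).
  (* Every monomial lies in [H], so every leading term is realized in [M], whose elements
     commute. *)
  have lead h c : c != 0 -> exists2 m, M m & leading_term m h c.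
    move=> c0; have lc := leading_term_monomial h c0.
    have [|_ [m Mm [k [e [lk lm]]]]] := HT (mn_monomial h c).
      exact: leading_term_star (@mn_carrier_monomial h c) lc.
    by exists m => //; have [-> ->] := leading_term_uniq lc lk.
  have [m Mm lm] := lead g a a0; have [n Mn ln] := lead d b b0.
  have := leading_term_mul ln lm; rewrite -Mab // [d + g]addrC.
  by move=> /(leading_term_uniq (leading_term_mul lm ln))[].
have subH : subgroup_of mul one (mn_star G A) H.
  split=> //.
  - split; first exact: leading_term_star (@mn_carrier_monomial 0 1) leading_term_one.
    by exists one => //; exists 0, 1; split; exact: leading_term_one.
  - move=> phi psi [[cphi _] [m Mm [h [c [lphi lm]]]]].
    move=> [[cpsi _] [n Mn [k [e [lpsi ln]]]]].
    have lmul := leading_term_mul lphi lpsi; split.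
      exact: leading_term_star (mn_carrier_mul cphi cpsi) lmul.
    exists (mul m n); first exact: MM.
    by eexists; eexists; split; [exact: lmul|exact: leading_term_mul].
  - move=> phi [sphi [m Mm [h [c [lphi lm]]]]].
    have [psi [spsi phipsi psiphi]] := mn_inverse sphi.
    have [n [Mn mn nm]] := MV m Mm.
    (* The inverse [n] of [m] in [M] has the same leading term as [psi]. *)
    exists psi; split=> //; split=> //; exists n => //.
    have [k [e lpsi]] := leading_term_exists spsi.
    have [k' [e' ln]] := leading_term_exists (Msub n Mn).
    exists k, e; split=> //.
    by have [-> ->] := leading_term_inverse phipsi mn lphi lm lpsi ln.
(* [H] contains [M] and is proper in this case, so maximality forbids a strict inclusion. *)
have HM : H `<=` M.
  apply: contrapT => HNM; apply: (Mmax H subH) => //.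
  split=> // m Mm; have [h [c lm]] := leading_term_exists (Msub m Mm).
  by split; [exact: Msub|exists m => //; exists h, c].
have Mone_plus h c : 0 < h -> M (one_plus_monomial h c).
  move=> h0; apply: HM; have l1 := leading_term_one_plus c h0.
  split; first exact: leading_term_star (@mn_carrier_one_plus h c) l1.
  by exists one => //; exists 0, 1; split; last exact: leading_term_one.
rewrite -mul_one_plus_coef // Mab; try exact: Mone_plus.
by rewrite addrC mul_one_plus_coef.
Qed.

End Series.

Theorem proposition4p5
  (A : unitRingType) (hA : division_ring A)
  (Gamma : porderZmodType) (hGamma : totally_ordered_group Gamma)
  (omega : Gamma -> {rmorphism A -> A})
  (omega_bij : forall g, bijective (omega g))
  (f : Gamma -> Gamma -> A) (f_neq0 : forall g d, f g d != 0)
  (f_cocycle : forall g d e,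
     omega g (f d e) * f g (d + e) = f g d * f (g + d) e)
  (omega_comp : forall g d a,
     omega g (omega d a) = f g d * omega (g + d) a * (f g d)^-1)
  (omega0 : forall a, omega 0 a = a)
  (f0l : forall g, f 0 g = 1) (f0r : forall g, f g 0 = 1)
  (hcond :
     [\/ (exists (g : Gamma) (a : A), 0 < g /\ omega g a <> a),
         (exists g d : Gamma, [/\ 0 < g, 0 < d & f g d <> f d g]) |
         (exists (g : Gamma) (a b : A), 0 < g /\ a * omega g b <> b * omega g a)]) :
  ~ exists M : set (Gamma -> A),
      maximal_subgroup_of (mn_mul omega f) (mn_one Gamma A)
        (mn_star Gamma A) M
      /\ abelian_for (mn_mul omega f) M.
Proof.
case=> M [Mmax Mab].
have comm := abelian_maximal_leading_comm hA hGamma f_neq0 f_cocycle omega_comp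
  omega0 f0l f0r Mmax Mab.
(* The case [d = g], after cancelling [f g g]; zero coefficients are treated apart. *)
have comm3 g a b : 0 < g -> a * omega g b = b * omega g a.
  move=> g0; have [->|a0] := eqVneq a 0; first by rewrite rmorph0 mulr0 mul0r.
  have [->|b0] := eqVneq b 0; first by rewrite rmorph0 mulr0 mul0r.
  exact/(mulIr (hA _ (f_neq0 g g)))/comm.
(* Taking 1 as the first coefficient in [comm3] refutes the first condition; taking 1 for both
   coefficients in [comm] refutes the second. *)
case: hcond => [[g [a [g0]]]|[g [d [g0 d0]]]|[g [a [b [g0]]]]]; apply.
- by have := comm3 g 1 a g0; rewrite rmorph1 mulr1 mul1r.
- have := comm g d 1 1 g0 d0 (oner_neq0 A) (oner_neq0 A).
  by rewrite !rmorph1 !mul1r.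
- exact: comm3.
Qed.
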